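(* Let $\mathcal H$ be a finite-dimensional Hilbert space over $\mathbb C$. If $T \in \mathbf{B}(\mathcal H)$, then $T$ is not subspace-hypercyclic for any nonzero subspace $\mathcal M$ of $\mathcal H$.
   Context: $\mathbf{B}(\mathcal H)$ is the set of bounded linear operators on $\mathcal H$; $\mathbb N_0 = \mathbb N\cup\{0\}$. For $x\in\mathcal H$, $\operatorname{Orb}(T,x) := \{T^n x : n\in\mathbb N_0\}$. $T$ is subspace-hypercyclic for a nonzero (closed linear) subspace $\mathcal M$ if there exists $x\in\mathcal H$ such that $\operatorname{Orb}(T,x)\cap\mathcal M$ is dense in $\mathcal M$. *)

(* Defs.v *)
From HB Require Import structures.
From mathcomp Require Import all_boot all_order all_algebra.
From mathcomp Require Import complex.
From mathcomp Require Import all_classical all_reals all_analysis.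

Set Implicit Arguments.
Unset Strict Implicit.
Unset Printing Implicit Defensive.

Import Order.TTheory GRing.Theory Num.Theory.
Import numFieldNormedType.Exports.

Local Open Scope classical_set_scope.
Local Open Scope complex_scope.
Local Open Scope ring_scope.

(* A complex Hilbert space is a [completeNormedModType R[i]] together with an
   inner product, linear in its first argument, that induces the norm. *)
Definition induces_norm (R : realType) (H : normedModType R[i])
    (dot : {dot H for Num.conj}) : Prop :=
  forall x : H, `|x| = sqrtC (dot x x).

Definition finite_dimensional (K : numFieldType) (V : lmodType K) : Prop :=
  exists (n : nat) (e : 'I_n -> V),
    forall x : V, exists c : 'I_n -> K, x = \sum_(i < n) c i *: e i.

Definition bounded_operator (R : realType) (H : normedModType R[i])
    (T : {linear H -> H}) : Prop :=
  exists r : R, forall x : H, `|T x| <= r%:C * `|x|.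

Definition closed_subspace (K : numFieldType) (H : normedModType K)
    (M : set H) : Prop :=
  submod_closed [in M] /\ closed M.

Definition Orb (X : Type) (T : X -> X) (x : X) : set X :=
  range (fun n : nat => iter n T x).

(* Density in the subspace topology of [M]. *)
Definition dense_in (X : topologicalType) (A M : set X) : Prop :=
  A `<=` M /\ M `<=` closure A.

Definition subspace_hypercyclic (K : numFieldType) (H : normedModType K)
    (T : H -> H) (M : set H) : Prop :=
  exists x : H, dense_in (Orb T x `&` M) M.

(* Main.v *)
Require Import Defs.
From mathcomp Require Import all_boot all_order all_algebra.
From mathcomp Require Import complex.
From mathcomp Require Import all_classical all_reals all_analysis.
From mathcomp Require Import ring.

Set Implicit Arguments.
Unset Strict Implicit.
Unset Printing Implicit Defensive.

Import Order.TTheory GRing.Theory Num.Theory.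
Import numFieldNormedType.Exports.

Local Open Scope classical_set_scope.
Local Open Scope complex_scope.
Local Open Scope ring_scope.

(* Since [M <> 0], some bounded functional [phi] does not vanish on [M].  The
   bounded functionals form a finite-dimensional space stable under composition
   with [T], so [phi] can be taken to be a generalized eigenvector of the
   transpose of [T], for some eigenvalue [l].  Then [u n = phi (T^n x)] is killed
   by a power of [S - l], [S] being the shift: it is bounded if [|l| < 1], and
   otherwise [u n = l^n * p(n)] for a polynomial [p], so that [|u n|] tends to
   infinity if [p] is not constant and is [0] or bounded below by [|p(0)|] if it
   is.  In each case [u] is not dense in [C], whereas [phi] maps a dense subset
   of [M] to a dense subset of [C]. *)

(** * Generalized eigenvectors inside a stable subspace *)

Lemma horner_mx_mulmx_stable (F : fieldType) (n : nat) (A : 'M[F]_n.+1)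
    (P : 'cV[F]_n.+1 -> Prop) (PD : forall v w, P v -> P w -> P (v + w))
    (PZ : forall a v, P v -> P (a *: v)) (PA : forall v, P v -> P (A *m v))
    (q : {poly F}) (v : 'cV[F]_n.+1) :
  P v -> P (horner_mx A q *m v).
Proof.
elim/poly_ind: q v => [|q a IHq] v Pv.
  by rewrite rmorph0 mul0mx -(scale0r v); exact: PZ.
rewrite rmorphD rmorphM /= horner_mx_X horner_mx_C mulmxDl -mulmxA.
by apply: PD; [apply/IHq/PA | rewrite mul_scalar_mx; exact: PZ].
Qed.

(* If an annihilating polynomial of [v] is [r * ('X - l)^m] with [r.[l] != 0],
   Bezout splits [v] into a part killed by [(A - l)^m] and a part killed by [r];
   the functional [c] does not vanish on both. *)
Lemma generalized_eigenvector_exists (F : closedFieldType) (n : nat)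
    (A : 'M[F]_n.+1) (P : 'cV[F]_n.+1 -> Prop)
    (PD : forall v w, P v -> P w -> P (v + w))
    (PZ : forall a v, P v -> P (a *: v)) (PA : forall v, P v -> P (A *m v))
    (c : 'rV[F]_n.+1) (v : 'cV[F]_n.+1) :
  P v -> c *m v != 0 ->
  exists l k w, [/\ P w, c *m w != 0 & (A - l%:M) ^+ k *m w = 0].
Proof.
suff killed q : q != 0 -> forall v, P v -> c *m v != 0 ->
    horner_mx A q *m v = 0 ->
    exists l k w, [/\ P w, c *m w != 0 & (A - l%:M) ^+ k *m w = 0].
  move=> Pv cv; apply: (killed (char_poly A)) Pv cv _.
    exact/monic_neq0/char_poly_monic.
  by rewrite Cayley_Hamilton mul0mx.
have [d] := ubnP (size q); elim: d => // d IHd in q *.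
move=> szq q0 w Pw cw qw.
have [sz1|sz1] := eqVneq (size q) 1%N.
  have /size_poly1P[a a0 qa] : size q == 1 by rewrite sz1.
  move: qw; rewrite qa horner_mx_C mul_scalar_mx => /eqP.
  rewrite scaler_eq0 (negPf a0) /= => /eqP w0.
  by rewrite w0 mulmx0 eqxx in cw.
have [l ql] := closed_rootP _ sz1.
have [m [r]] := multiplicity_XsubC q l; rewrite q0 /= => rl qE.
have m0 : (0 < m)%N.
  by case: m qE => // qE; move: ql; rewrite qE expr0 mulr1 (negPf rl).
have := rl; rewrite -coprimep_XsubC => /(coprimep_expr m).
move=> /Bezout_eq1_coprimepP[[u1 u2] /= /(congr1 (horner_mx A))].
rewrite rmorphD rmorph1 => /(congr1 (mulmx^~ w)); rewrite mul1mx mulmxDl => wE.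
have N0 : horner_mx A ('X - l%:P) = A - l%:M.
  by rewrite rmorphB /= horner_mx_X horner_mx_C.
have [c1|c1] := eqVneq (c *m (horner_mx A (u1 * r) *m w)) 0; last first.
  exists l, m, (horner_mx A (u1 * r) *m w); split=> //.
    exact: horner_mx_mulmx_stable.
  rewrite -N0 -rmorphXn mulmxA -[_ *m horner_mx A _]rmorphM mulrC -mulrA -qE.
  by rewrite rmorphM -mulmxA qw mulmx0.
(* The part killed by [r] remains; [r] has smaller size than [q] because [m > 0]. *)
apply: (IHd r _ _ (horner_mx A (u2 * ('X - l%:P) ^+ m) *m w)).
- move: szq; rewrite qE size_Mmonic ?monic_exp ?monicXsubC//.
    rewrite size_exp_XsubC addnS /= ltnS => /(leq_trans _); apply.
    by rewrite -addn1 leq_add2l.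
  by apply: contraNneq q0 => r0; rewrite qE r0 mul0r.
- by apply: contraNneq q0 => r0; rewrite qE r0 mul0r.
- exact: horner_mx_mulmx_stable.
- by move: cw; rewrite -{1}wE mulmxDr c1 add0r.
- rewrite mulmxA -[_ *m horner_mx A _]rmorphM mulrCA -qE.
  by rewrite rmorphM -mulmxA qw mulmx0.
Qed.

(** * Sequences killed by a power of [S - l] *)

Definition twisted_diff (K : pzRingType) (l : K) (u : nat -> K) : nat -> K :=
  fun n => u n.+1 - l * u n.

(** Writing [u n = l ^+ n * w n] turns [twisted_diff l] into [l ^+ n.+1] times the forward
    difference of [w], so this is Newton's forward difference formula for [w]. *)
Lemma binomial_expansion (K : fieldType) (l : K) k u :
    l != 0 -> iter k (twisted_diff l) u =1 (fun=> 0) ->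
  exists c : nat -> K,
    forall n, u n = l ^+ n * \sum_(j < k) c j * 'C(n, j)%:R.
Proof.
move=> l0; elim: k u => [|k IHk] u.
  by move=> u0; exists (fun=> 0) => n; rewrite big_ord0 mulr0 -(u0 n).
rewrite iterSr => /IHk[c cE].
(* Summation raises ['C(n, j)] to ['C(n, j.+1)]; the division by [l] absorbs the extra factor in
   [l ^+ n.+1]. *)
pose d j := if j is j'.+1 then c j' / l else u 0%N.
exists d => n.
elim: n => [|n IHn].
  rewrite expr0 mul1r big_ord_recl bin0 mulr1 big1 ?addr0// => i _.
  by rewrite bin0n mulr0.
have -> : u n.+1 = l * u n + twisted_diff l u n.
  by rewrite /twisted_diff addrC subrK.
have -> : \sum_(j < k.+1) d j * 'C(n.+1, j)%:R =
    \sum_(j < k.+1) d j * 'C(n, j)%:R + l^-1 * \sum_(j < k) c j * 'C(n, j)%:R.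
  rewrite !big_ord_recl !bin0 -addrA; congr (_ + _).
  rewrite mulr_sumr -big_split; apply: eq_bigr => i _ /=.
  rewrite /bump add1n binS natrD mulrDr /=; congr (_ + _).
  by rewrite mulrAC mulrC.
rewrite cE IHn mulrDr mulrA -exprS; congr (_ + _).
by rewrite exprSr mulrA mulfK.
Qed.

Lemma bounded_of_contracting (K : numFieldType) (l : K) k u :
    `|l| < 1 -> iter k (twisted_diff l) u =1 (fun=> 0) ->
  exists2 B, 0 <= B & forall n, `|u n| <= B.
Proof.
move=> l1; elim: k u => [|k IHk] u.
  by move=> /= u0; exists 0 => // n; rewrite u0 normr0.
rewrite iterSr => /IHk[B B0 uB].
have l1' : 0 < 1 - `|l| by rewrite subr_gt0.
have D0 : 0 <= B / (1 - `|l|) by rewrite divr_ge0// ltW.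
(* [B / (1 - |l|)] is the fixed point of [t |-> |l| * t + B], which controls one step of the
   recursion. *)
exists (`|u 0%N| + B / (1 - `|l|)) => [|n]; first by rewrite addr_ge0.
elim: n => [|n IHn]; first by rewrite lerDl.
have -> : u n.+1 = l * u n + twisted_diff l u n.
  by rewrite /twisted_diff addrC subrK.
apply: (le_trans (ler_normD _ _)); rewrite normrM.
apply: (le_trans (lerD (ler_wpM2l _ IHn) (uB n))) => //.
rewrite mulrDr -addrA; apply: lerD; first by rewrite ler_piMl// ltW.
by rewrite -lerBrDl -[X in X - _]mul1r -mulrBl mulrC divfK ?lt0r_neq0.
Qed.

Lemma real_complex_archi (R : realType) (x : R[i]) :
  0 <= x -> exists n : nat, x <= n%:R.
Proof.
move=> x0; exists (Num.bound (complex.Re x)).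
have /RRe_real <- := ger0_real x0.
have : complex.Re x < (Num.bound (complex.Re x))%:R.
  by apply: archi_boundP; move: x0; rewrite lecE => /andP[].
by rewrite -ltcR rmorph_nat => /ltW.
Qed.

(** Induction along Horner's scheme [p = q * 'X + c]: [q] is either nonconstant or a nonzero
    constant, and the factor [n] does the rest. *)
Lemma poly_norm_unbounded (R : realType) (p : {poly R[i]}) :
  (1 < size p)%N -> forall B : R[i], 0 <= B ->
  exists N : nat, forall n : nat, (N <= n)%N -> B <= `|p.[n%:R]|.
Proof.
elim/poly_ind: p => [|q c IHq]; first by rewrite size_poly0.
move=> szp B B0.
suff [N qN] : exists N : nat, forall n, (N <= n)%N ->
    B + `|c| <= `|q.[n%:R] * n%:R|.
  exists N => n /qN qn; rewrite hornerMXaddC.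
  by apply: le_trans (lerB_normD _ _); rewrite lerBrDr.
have [q1|q1] := ltnP 1 (size q).
  have [N qN] := IHq q1 (B + `|c|) (addr_ge0 B0 (normr_ge0 c)).
  exists (maxn 1 N) => n; rewrite geq_max => /andP[n1 /qN /le_trans]; apply.
  by rewrite normrM normr_nat ler_peMr// ler1n.
have qE := size1_polyC q1.
have q0 : q`_0 != 0.
  apply: contraTneq szp => q0; rewrite qE q0 mul0r add0r size_polyC.
  by case: (c != 0).
have a0 : 0 < `|q`_0| by rewrite normr_gt0.
have [|N xN] := @real_complex_archi R ((B + `|c|) / `|q`_0|).
  by rewrite divr_ge0// addr_ge0.
exists N => n Nn; rewrite qE hornerC normrM normr_nat mulrC -ler_pdivrMr//.
by rewrite (le_trans xN)// ler_nat.
Qed.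

Lemma poly_binomial (K : numFieldType) j :
  exists b : {poly K}, forall n, b.[n%:R] = 'C(n, j)%:R.
Proof.
elim: j => [|j [b bE]]; first by exists 1 => n; rewrite hornerC bin0.
exists (j.+1%:R^-1 *: (('X - j%:R%:P) * b)) => n.
rewrite hornerZ hornerM hornerXsubC bE.
apply: (mulfI (_ : j.+1%:R != 0)); first by rewrite pnatr_eq0.
rewrite mulVKf ?pnatr_eq0// -natrM mul_bin_left natrM.
(* Subtraction on [nat] truncates when [n < j], but then both sides vanish. *)
have [nj|jn] := ltnP n j; first by rewrite bin_small// !mulr0.
by rewrite natrB.
Qed.

(** Nested disks in the unit disk, each shrunk to avoid one more term. *)
Lemma avoid_finitely_many (K : numFieldType) (u : nat -> K) N :
  exists z e, [/\ 0 < e, `|z| + e <= 1 &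
    forall n, (n < N)%N -> e <= `|z - u n|].
Proof.
elim: N => [|N [z [e [e0 ze zu]]]].
  by exists 0, 1; rewrite normr0 add0r ltr01 lexx.
have e2 : 0 < e / 2 by rewrite divr_gt0.
have e4 : 0 < e / 4 by rewrite divr_gt0.
have [far|near] := real_leP (ger0_real (ltW e2)) (normr_real (z - u N)).
  exists z, (e / 2); split=> //.
    by apply: le_trans ze; rewrite lerD2l ler_pdivrMr// ler_peMr ?ler1n// ltW.
  move=> n; rewrite ltnS leq_eqVlt => /predU1P[->//|/zu]; apply: le_trans.
  by rewrite ler_pdivrMr// ler_peMr ?ler1n// ltW.
have nE : `|3 * (e / 4)| = 3 * (e / 4) by rewrite ger0_norm// mulr_ge0// ltW.
have eE : e = e / 4 + 3 * (e / 4) by field.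
(* The smaller disk stays in the old one since [3e/4 + e/4 = e], and its center is at least
   [3e/4 - e/2 = e/4] away from [u N]. *)
exists (z + 3 * (e / 4)), (e / 4); split=> //.
  apply: le_trans ze; rewrite [in leRHS]eE [e / 4 + _]addrC addrA lerD2r.
  by rewrite (le_trans (ler_normD _ _))// nE.
move=> n; rewrite ltnS leq_eqVlt addrAC => /predU1P[->|nN].
  have := lerB_normD (3 * (e / 4)) (z - u N); rewrite addrC nE; apply: le_trans.
  rewrite lerBrDr (le_trans (lerD (lexx _) (ltW near)))//.
  have -> // : e / 4 + e / 2 = 3 * (e / 4) by field.
have := lerB_normD (z - u n) (3 * (e / 4)); rewrite nE; apply: le_trans.
by rewrite lerBrDr -eE zu.
Qed.

Lemma jordan_sequence_not_dense (R : realType) (l : R[i]) k u :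
    iter k (twisted_diff l) u =1 (fun=> 0) ->
  exists z e, 0 < e /\ forall n, e <= `|z - u n|.
Proof.
have [l1|l1 uk] := real_ltP (normr_real l) (@real1 R[i]).
  move=> /(bounded_of_contracting l1)[B B0 uB].
  exists (B + 1), 1; split=> // n; apply: le_trans (lerB_dist _ _).
  by rewrite ger0_norm ?addr_ge0// lerBrDr addrC lerD2r.
have l0 : l != 0 by rewrite -normr_gt0 (lt_le_trans ltr01).
have ln n : 1 <= `|l ^+ n| by rewrite normrX exprn_ege1.
have [c cE] := binomial_expansion l0 uk.
have [b bE] := choice (@poly_binomial R[i]).
pose p := \sum_(j < k) c j *: b j.
have pE n : u n = l ^+ n * p.[n%:R].
  rewrite cE horner_sum; congr (_ * _); apply: eq_bigr => j _.
  by rewrite hornerZ bE.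
have pu n : `|p.[n%:R]| <= `|u n| by rewrite pE normrM ler_peMl.
have [sp|sp] := ltnP 1 (size p).
  (* From [N] on the terms lie outside the open unit disk; the earlier ones are finitely many. *)
  have [N pN] := poly_norm_unbounded sp (@ler01 R[i]).
  have [z [e [e0 ze zu]]] := avoid_finitely_many u N.
  exists z, e; split=> // n; have [/zu//|/pN Nn] := ltnP n N.
  rewrite distrC; apply: le_trans (lerB_dist _ _).
  by rewrite lerBrDr addrC (le_trans ze)// (le_trans Nn).
have [p0|p0] := eqVneq p`_0 0.
  exists 1, 1; split=> // n.
  by rewrite pE (size1_polyC sp) p0 hornerC mulr0 subr0 normr1.
exists 0, `|p`_0|; split=> [|n]; first by rewrite normr_gt0.
rewrite sub0r normrN; apply: le_trans (pu n).
by rewrite [in leRHS](size1_polyC sp) hornerC.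
Qed.

(** * Bounded functionals along an orbit *)

Lemma cauchy_schwarz (R : realType) (H : normedModType R[i])
    (dot : {dot H for Num.conj}) (dot_norm : induces_norm dot) (u v : H) :
  `|dot u v| <= `|u| * `|v|.
Proof.
have [->|v0] := eqVneq v 0; first by rewrite linear0r !normr0 mulr0.
have vv0 : 0 < dot v v by rewrite dnorm_gt0.
(* [a *: v] is the orthogonal projection of [u] on [v]; Pythagoras concludes. *)
pose a := dot u v / dot v v; pose w := u - a *: v.
have wv : dot w v = 0.
  by rewrite linearBl /= linearZl_LR divfK ?lt0r_neq0// subrr.
have uE : dot u u = dot w w + `|a| ^+ 2 * dot v v.
  rewrite -dnormZ -hnormDd ?subrK//.
  by rewrite linearZr_LR /= wv mulr0.
rewrite !dot_norm -sqrtCM ?nnegrE ?dnorm_ge0//.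
rewrite -(sqrCK (normr_ge0 _)) ler_sqrtC ?nnegrE ?exprn_ge0
  ?mulr_ge0 ?dnorm_ge0//.
have -> : dot u v = a * dot v v by rewrite divfK ?lt0r_neq0.
rewrite normrM (gtr0_norm vv0) exprMn [dot v v ^+ 2]expr2 mulrA ler_pM2r//.
by rewrite uE lerDr dnorm_ge0.
Qed.

Theorem theorem4p9 (R : realType) (H : completeNormedModType R[i])
    (dot : {dot H for Num.conj}) (dot_norm : induces_norm dot)
    (H_fin : finite_dimensional H)
    (T : {linear H -> H}) (T_bounded : bounded_operator T)
    (M : set H) (M_sub : closed_subspace M) (M_neq0 : M <> [set 0]) :
  ~ subspace_hypercyclic T M.
Proof.
move=> [x [_ M_cl]]; have [[M0 Mlin] _] := M_sub.
have [m Mm m_neq0] : exists2 m, M m & m != 0.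
  apply: contrapT => noM; apply: M_neq0; apply/seteqP; split => [y My|_ ->].
    by apply: contrapT => /= /eqP y0; apply: noM; exists y.
  exact: set_mem M0.
have [[|n] [e e_span]] := H_fin.
  by have [c mE] := e_span m; rewrite mE big_ord0 eqxx in m_neq0.
(* The family [e] only spans, so [E] may fail to be injective. A column [v] bounded in terms of
   [|E c|] still defines a functional on [H], as it vanishes where [E c = 0]. *)
pose E (c : 'rV[R[i]]_n.+1) : H := \sum_i c 0 i *: e i.
have E_surj y : exists c, y = E c.
  have [c ->] := e_span y; exists (\row_i c i).
  by apply: eq_bigr => i _; rewrite mxE.
have EB c d : E c - E d = E (c - d).
  by rewrite -sumrB; apply: eq_bigr => i _; rewrite !mxE scalerBl.
have EZ a c : E (a *: c) = a *: E c.
  by rewrite scaler_sumr; apply: eq_bigr => i _; rewrite mxE scalerA.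
have [co coE] := choice (fun i => E_surj (T (e i))).
pose A : 'M[R[i]]_n.+1 := \matrix_(i, j) co i 0 j.
have TE c : T (E c) = E (c *m A).
  rewrite linear_sum /=.
  under eq_bigr do rewrite linearZ /= coE scaler_sumr.
  rewrite exchange_big; apply: eq_bigr => j _ /=; rewrite mxE scaler_suml.
  by apply: eq_bigr => i _; rewrite mxE scalerA.
have iterTE c k : iter k T (E c) = E (c *m A ^+ k).
  elim: k => [|k IHk]; first by rewrite expr0 mulmx1.
  by rewrite iterS IHk TE exprSr mulmxA.
(* The columns [v] for which [E c |-> c *m v] is a bounded functional. *)
pose P (v : 'cV[R[i]]_n.+1) :=
  exists2 B, 0 <= B & forall c, `|(c *m v) 0 0| <= B * `|E c|.
have PD v w : P v -> P w -> P (v + w).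
  move=> [B B0 vB] [C C0 wC]; exists (B + C) => [|c]; first exact: addr_ge0.
  by rewrite mulmxDr mxE mulrDl (le_trans (ler_normD _ _))// lerD.
have PZ a v : P v -> P (a *: v).
  move=> [B B0 vB]; exists (`|a| * B) => [|c]; first exact: mulr_ge0.
  by rewrite -scalemxAr mxE normrM -mulrA ler_wpM2l.
have [r Tr] := T_bounded.
have PA v : P v -> P (A *m v).
  move=> [B B0 vB]; exists (B * `|r|%:C) => [|c].
    by rewrite mulr_ge0// ler0c.
  rewrite mulmxA (le_trans (vB _))// -mulrA ler_wpM2l// -TE.
  by rewrite (le_trans (Tr _))// ler_wpM2r// lecR ler_norm.
(* The starting functional is [dot _ m], nonzero at [m] itself. *)
pose v0 : 'cV[R[i]]_n.+1 := \col_i dot (e i) m.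
have v0E c : (c *m v0) 0 0 = dot (E c) m.
  rewrite mxE linear_sumlz /=; apply: eq_bigr => i _.
  by rewrite mxE linearZl_LR.
have Pv0 : P v0.
  exists `|m| => // c; rewrite v0E mulrC; exact: cauchy_schwarz.
have [c mE] := E_surj m.
have cv0 : c *m v0 != 0.
  apply: contra_neq m_neq0 => /matrixP/(_ 0 0); rewrite v0E -mE mxE => /eqP.
  by rewrite dnorm_eq0 => /eqP.
have [l [k [v [[B B0 vB] cv Nv]]]] :=
  generalized_eigenvector_exists PD PZ PA Pv0 cv0.
have [d xE] := E_surj x.
pose u j := (d *m A ^+ j *m v) 0 0.
(* Shifting [u] amounts to replacing [v] by [A *m v], so [S - l] acts on [u] as [A - l%:M] acts on
   [v]. *)
have diffE i j : iter i (twisted_diff l) u j =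
    (d *m A ^+ j *m ((A - l%:M) ^+ i *m v)) 0 0.
  elim: i j => [|i IHi] j; first by rewrite expr0 mul1mx.
  have -> : (A - l%:M) ^+ i.+1 *m v =
      A *m ((A - l%:M) ^+ i *m v) - l *: ((A - l%:M) ^+ i *m v).
    by rewrite exprS -mul_scalar_mx -mulmxBl mulmxA.
  rewrite iterS /twisted_diff !IHi mulmxBr -scalemxAr exprSr.
  rewrite [RHS]mxE; congr (_ + _); last by rewrite !mxE.
  by rewrite -[A ^+ j * A]/(A ^+ j *m A) !mulmxA.
have [|z [eps [eps0 zu]]] := @jordan_sequence_not_dense R l k u.
  by move=> j; rewrite diffE Nv mulmx0 mxE.
pose a := (c *m v) 0 0.
have a0 : a != 0.
  by apply: contra_neq cv => a0; apply/matrixP => i j; rewrite !ord1 [RHS]mxE.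
have Mz : M ((z / a) *: m).
  by apply: set_mem; have := Mlin (z / a) m 0 (mem_set Mm) M0; rewrite addr0.
have B1 : 0 < B + 1 by rewrite ltr_wpDl.
(* The functional maps [(z / a) *: m] to [z], so an orbit point this close to it would put some
   [u j] within [eps] of [z]. Dividing by [B + 1] covers [B = 0]. *)
have /(M_cl _ Mz) [y [[[j _ jy] _]]] :
  nbhs ((z / a) *: m) (ball ((z / a) *: m) (eps / (B + 1))).
  by apply: nbhsx_ballx; rewrite divr_gt0.
rewrite -ball_normE /= -jy xE iterTE mE -EZ EB => near_z.
have := vB ((z / a) *: c - d *m A ^+ j).
have -> : (((z / a) *: c - d *m A ^+ j) *m v) 0 0 = z - u j.
  rewrite mulmxBl -scalemxAl mxE; congr (_ + _); last by rewrite mxE.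
  by rewrite mxE divfK.
move=> /(le_trans (zu j)) eps_le.
suff : eps < eps by rewrite ltxx.
apply: (le_lt_trans eps_le).
apply: le_lt_trans (ler_wpM2l B0 (ltW near_z)) _.
by rewrite mulrA ltr_pdivrMr// mulrDr mulr1 [eps * B]mulrC ltrDl.
Qed.
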